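(* For all integers $n > m \geq 1$, there is no embedding (injective monoid homomorphism) of the hypoplactic monoid $\mathsf{hypo}_n$ of rank $n$ into the hypoplactic monoid $\mathsf{hypo}_m$ of rank $m$.
   Context: Let $\mathcal{A} = \{1<2<3<\cdots\}$ be the ordered alphabet of positive integers and $\mathcal{A}_n = \{1<\cdots<n\}$. For a word $w$, $|w|_a$ is the number of occurrences of the letter $a$; the content of $w$ is the tuple $(|w|_a)_a$, and the support $\mathrm{supp}(w)$ is the set of letters occurring in $w$. A quasi-ribbon tableau is a finite grid of cells, aligned so that the leftmost cell in each row is below the rightmost cell of the previous row, filled with letters of $\mathcal{A}$ so that rows weakly increase from left to right and columns strictly increase from top to bottom. Krob--Thibon insertion of a letter $a$ into a quasi-ribbon tableau $T$: if no entry of $T$ is $\le a$, create a new cell $a$ and glue $T$ by its top-leftmost entry to the bottom of this cell; otherwise, let $x$ be the right-most and bottom-most entry of $T$ with $x \le a$, separate $T$ just after $x$, put a new entry $a$ to the right of $x$ and glue the remaining part of $T$ (below and to the right of $x$) onto the bottom of the new entry $a$. For $u \in \mathcal{A}^*$, $\mathrm{P}_{\mathsf{hypo}}(u)$ is the tableau obtained from the empty tableau by inserting the letters of $u$ from left to right. The hypoplactic congruence is: $u \equiv_{\mathsf{hypo}} v$ iff $\mathrm{P}_{\mathsf{hypo}}(u) = \mathrm{P}_{\mathsf{hypo}}(v)$. The hypoplactic monoid is $\mathsf{hypo} = \mathcal{A}^*/{\equiv_{\mathsf{hypo}}}$, and the hypoplactic monoid of rank $n$ is $\mathsf{hypo}_n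 = \mathcal{A}_n^*/{\equiv_{\mathsf{hypo}}}$. Known equivalent description (Novelli): $u \equiv_{\mathsf{hypo}} v$ iff $u$ and $v$ have the same content and the same inversions, where, if $\mathrm{supp}(u) = \{a_1<\dots<a_k\}$, $u$ has an $a_{i+1}$-$a_i$ inversion ($1 \le i \le k-1$) iff $a_{i+1}a_i$ is a (scattered) subsequence of $u$. *)

(* Defs.v *)
From HB Require Import structures.
From mathcomp Require Import all_boot all_order.

Set Implicit Arguments.
Unset Strict Implicit.
Unset Printing Implicit Defensive.

Import Order.TTheory.
Local Open Scope order_scope.

Section QuasiRibbonTableaux.

Variables (d : Order.disp_t) (A : orderType d).
Implicit Types (a b c x y : A) (r s u v w : seq A) (T S L G : seq (seq A)).

(* A quasi-ribbon tableau is encoded as its sequence of rows, from top to     *)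
(* bottom. The shape is determined by the lengths of the rows, as the         *)
(* leftmost cell of a row is just below the rightmost cell of the previous    *)
(* one; hence columns strictly increase iff consecutive rows are related by   *)
(* [row_above].                                                               *)
Definition row_above r s : bool :=
  if (r, s) is (x :: r', y :: _) then last x r' < y else false.

Definition quasi_ribbon T : bool :=
  all (fun r => (r != [::]) && sorted <=%O r) T && sorted row_above T.

(* Krob-Thibon insertion. The right-most and bottom-most entry x <= a is the  *)
(* last such entry when T is read row by row, from top to bottom. In its row  *)
(* r, the entries up to and including x are [take k r]; the rest of the row   *)
(* (if any) and the rows below it are glued below the new entry.              *)
Fixpoint insert T a : seq (seq A) :=
  if T is r :: T' then
    if has (<= a) (flatten T') then r :: insert T' a
    else if has (<= a) r then
      let k := (size r - find (<= a) (rev r))%N in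
      rcons (take k r) a ::
        (if drop k r is [::] then T' else drop k r :: T')
    else [:: a] :: T
  else [:: [:: a]].

Definition P_hypo u : seq (seq A) := foldl insert [::] u.

Definition hypo_congr : rel (seq A) := fun u v => P_hypo u == P_hypo v.

Local Definition tab T := all (fun r => (r != [::]) && sorted <=%O r) T
  && pairwise (allrel <%O) T.

Local Definition restr (p : pred A) T :=
  [seq s <- [seq filter p r | r <- T] | s != [::]].

Local Definition same_row T b c := has (fun r => (b \in r) && (c \in r)) T.

Local Fixpoint addlast L a :=
  if L is r :: L' then
    if L' is [::] then [:: rcons r a] else r :: addlast L' a
  else [:: [:: a]].

Local Lemma tab_cons r T : tab (r :: T) =
  [&& r != [::], sorted <=%O r, allrel <%O r (flatten T) & tab T].
Proof.
rewrite /tab /= -!andbA; congr (_ && (_ && _)).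
have -> : all (allrel <%O r) T = allrel <%O r (flatten T).
  elim: T => [|s T IH] /=; first by rewrite allrel0r.
  by rewrite allrel_catr IH.
by rewrite andbCA.
Qed.

Local Lemma tab_cat L G : tab (L ++ G) =
  [&& tab L, tab G & allrel <%O (flatten L) (flatten G)].
Proof.
elim: L => [|r L IH]; first by rewrite allrel0l andbT.
rewrite cat_cons !tab_cons IH flatten_cat allrel_catr /= allrel_catl -!andbA.
by do 4!bool_congr.
Qed.

Local Lemma tab_quasi_ribbon T : tab T -> quasi_ribbon T.
Proof.
case/andP=> T1 T2; rewrite /quasi_ribbon T1 /=.
move: T1 T2 => /allP T1 /pairwise_sorted.
apply: (sub_in_sorted (P := fun s => s != [::])); last first.
  by apply/allP=> r /T1 /andP[].
move=> [|x r] [|y s] // _ _ /allrelP H; apply: H; last exact: mem_head.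
exact: mem_last.
Qed.

Local Lemma tab_sorted T : tab T -> sorted <=%O (flatten T).
Proof.
elim: T => // r T IH; rewrite tab_cons => /and4P[_ sr rT /IH].
rewrite /= !(sorted_pairwise le_trans) in sr * => sT.
rewrite pairwise_cat sr sT !andbT.
by apply: sub_allrel rT => x y /ltW.
Qed.

Local Lemma flatten_restr p T : flatten (restr p T) = filter p (flatten T).
Proof.
elim: T => // r T IH; rewrite /= filter_cat -IH /restr /=.
by case: (filter p r).
Qed.

Local Lemma tab_restr p T : tab T -> tab (restr p T).
Proof.
elim: T => // r T IH; rewrite tab_cons => /and4P[_ sr rT /IH tT].
rewrite /restr /= -/(restr p T); case: ifP => // fr.
rewrite tab_cons fr tT sorted_filter // ?andbT /=; last exact: le_trans.
apply/allrelP=> x y; rewrite flatten_restr !mem_filter.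
by case/andP=> _ xr /andP[_ yT]; apply: (allrelP rT).
Qed.

Local Lemma same_row_restr p T b c :
  same_row (restr p T) b c = [&& p b, p c & same_row T b c].
Proof.
rewrite /same_row /restr; elim: T => [|r T IH] /=; first by rewrite !andbF.
rewrite !andb_orr -IH.
have -> : [&& p b, p c, b \in r & c \in r]
   = (b \in filter p r) && (c \in filter p r).
  by rewrite !mem_filter; do !bool_congr.
by case: (filter p r).
Qed.

Local Lemma same_row_mem T b c :
  same_row T b c -> (b \in flatten T) && (c \in flatten T).
Proof.
by case/hasP=> r rT /andP[br cr]; apply/andP; split; apply/flattenP; exists r.
Qed.

Local Lemma flatten_addlast L a : flatten (addlast L a) = rcons (flatten L) a.
Proof.
elim: L => // r [|s L] IH; first by rewrite /= !cats0.
by rewrite [addlast _ _]/= -/(addlast (s :: L) a) /= [flatten _]IH rcons_cat.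
Qed.

Local Lemma restr_none p T : ~~ has p (flatten T) -> restr p T = [::].
Proof.
elim: T => // r T IH; rewrite /= has_cat negb_or => /andP[pr /IH].
by rewrite /restr /= => ->; move: pr; rewrite has_filter negbK => /eqP ->.
Qed.

Local Lemma restr_all p T :
  tab T -> all p (flatten T) -> restr p T = T.
Proof.
elim: T => // r T IH; rewrite tab_cons all_cat => /and4P[r0 _ _ tT].
by case/andP=> /all_filterP pr /(IH tT); rewrite /restr /= pr r0 => ->.
Qed.

Local Lemma sorted_le_split a r : sorted <=%O r ->
  r = [seq x <- r | x <= a] ++ [seq x <- r | a < x].
Proof.
move=> sr; apply: (sorted_eq le_trans le_anti) => //; last first.
  have <- : [seq x <- r | ~~ (x <= a)] = [seq x <- r | a < x].
    by apply: eq_filter => x; rewrite ltNge.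
  by rewrite perm_sym; apply/permPl/perm_filterC.
rewrite (sorted_pairwise le_trans) in sr; rewrite (sorted_pairwise le_trans).
rewrite pairwise_cat !pairwise_filter // !andbT.
apply/allrelP=> x y; rewrite !mem_filter => /andP[xa _] /andP[ay _].
exact: le_trans xa (ltW ay).
Qed.

Local Lemma insertE T a : tab T ->
  insert T a = addlast (restr (<= a) T) a ++ restr (> a) T.
Proof.
elim: T => // r T IH; rewrite tab_cons => /and4P[r0 sr rT tT] /=.
case: ifPn => hT.
  have /hasP[y yT ya] := hT.
  have ra : all (<= a) r.
    by apply/allP=> x xr; apply: le_trans ya; apply/ltW/(allrelP rT).
  have ra' : filter (> a) r = [::].
    apply/eqP; rewrite -[_ == _]negbK -has_filter; apply/hasPn => x /(allP ra).
    by rewrite /= -leNgt.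
  rewrite IH // /restr /= ra' (all_filterP ra) r0 /=.
  rewrite -!/(restr _ T).
  have: y \in flatten (restr (<= a) T) by rewrite flatten_restr mem_filter ya.
  by case: (restr (<= a) T).
have gT : restr (> a) T = T.
  apply: restr_all => //; apply/allP=> x xT /=; rewrite ltNge.
  by apply: contra hT => xa; apply/hasP; exists x.
have rE p : restr p (r :: T) =
  if filter p r != [::] then filter p r :: restr p T else restr p T by [].
rewrite !rE gT (restr_none hT) => {rE}.
case: ifPn => hr; last first.
  have rg : all (> a) r.
    apply/allP=> x xr /=; rewrite ltNge.
    by apply: contra hr => xa; apply/hasP; exists x.
  by rewrite (all_filterP rg) r0; move: hr; rewrite has_filter negbK => ->.
have -> : (size r - find (<= a) (rev r) = size [seq x <- r | (x <= a)%O])%N.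
  rewrite {1 2}(sorted_le_split a sr) rev_cat find_cat.
  rewrite has_rev size_cat size_rev.
  rewrite ifF; last first.
    by apply/negbTE/hasPn=> x; rewrite mem_filter /= ltNge => /andP[].
  suff -> : find (<= a) (rev [seq x <- r | x <= a]) = 0%N
    by rewrite addn0 addnK.
  have: all (<= a) (rev [seq x <- r | x <= a]) by rewrite all_rev filter_all.
  by case: (rev _) => //= x s /andP[->].
have -> : take (size [seq x <- r | x <= a]) r = [seq x <- r | x <= a].
  by rewrite {2}(sorted_le_split a sr) take_size_cat.
have -> : drop (size [seq x <- r | x <= a]) r = [seq x <- r | a < x].
  by rewrite {2}(sorted_le_split a sr) drop_size_cat.
move: hr; rewrite has_filter => -> /=.
by case: (filter (> a) r).
Qed.

Local Lemma addlast_rcons L r a : addlast (rcons L r) a = rcons L (rcons r a).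
Proof.
elim: L => // s L IH; rewrite rcons_cons /= -/addlast IH.
by case: (L).
Qed.

Local Lemma sorted_rcons s a :
  sorted <=%O (rcons s a) = sorted <=%O s && all (<= a) s.
Proof.
rewrite !(sorted_pairwise le_trans) -cats1 pairwise_cat /= andbT andbC.
by rewrite allrel1r.
Qed.

Local Lemma tab_addlast L a :
  tab L -> all (<= a) (flatten L) -> tab (addlast L a).
Proof.
case/lastP: L => [|L r]; first by [].
rewrite addlast_rcons -(cats1 _ r) -(cats1 _ (rcons r a)) !tab_cat.
rewrite !tab_cons flatten_cat all_cat /= !cats0.
case/and3P=> tL /and4P[r0 sr _ _] Lr /andP[_ ra].
rewrite tL sorted_rcons sr ra !allrel0r -cats1 allrel_catr Lr !andbT /=.
rewrite -size_eq0 size_cat addn1 /= allrel1r.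
apply/allP=> x xL; case: r r0 {sr} Lr ra => // y r _ /allrelP Lr /andP[ya _].
by apply: lt_le_trans ya; apply: Lr => //; apply: mem_head.
Qed.

Local Lemma same_row_addlast L a b c :
  same_row (addlast L a) b c =
  same_row L b c || (b \in a :: last [::] L) && (c \in a :: last [::] L).
Proof.
case/lastP: L => [|L r]; first by rewrite /same_row /= orbF.
rewrite addlast_rcons last_rcons /same_row !has_rcons !mem_rcons !in_cons.
by case: (has _ L); case: (b \in r); case: (c \in r); rewrite ?orbT ?orbF.
Qed.

Local Lemma P_hypoP u :
  [/\ tab (P_hypo u), perm_eq (flatten (P_hypo u)) u
    & forall b c, b \in u -> c \in u -> b <= c ->
        same_row (P_hypo u) b c = sorted <=%O [seq x <- u | b <= x <= c]].
Proof.
elim/last_ind: u => [|u a [tT pT sT]]; first by split.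
rewrite /P_hypo foldl_rcons -/(P_hypo u) insertE //.
set T := P_hypo u in tT pT sT *.
set L := restr (<= a) T; set G := restr (> a) T.
have tL : tab L by apply: tab_restr.
have tG : tab G by apply: tab_restr.
have La : all (<= a) (flatten L) by rewrite flatten_restr filter_all.
have Ga : all (> a) (flatten G) by rewrite flatten_restr filter_all.
have memL x : x \in flatten L = (x <= a) && (x \in u).
  by rewrite flatten_restr mem_filter (perm_mem pT).
have lL x : x \in last [::] L -> x \in flatten L.
  case/lastP: (L) => // L' l; rewrite last_rcons => xl.
  by apply/flattenP; exists l; rewrite // mem_rcons mem_head.
have lla x : x \in a :: last [::] L -> x <= a.
  by rewrite in_cons => /orP[/eqP->//|/lL]; rewrite memL => /andP[].
split.
- rewrite tab_cat tab_addlast // tG flatten_addlast /=.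
  apply/allrelP=> x y; rewrite mem_rcons => xa /(allP Ga) /=.
  apply: le_lt_trans; move: xa; rewrite in_cons => /orP[/eqP->//|].
  exact: (allP La).
- rewrite flatten_cat flatten_addlast !flatten_restr cat_rcons -cat_rcons.
  apply: (@perm_trans _ (a :: flatten T)).
    rewrite -cats1 -catA perm_catCA /= perm_cons.
    by rewrite -(sorted_le_split a (tab_sorted tT)).
  by rewrite perm_sym perm_rcons perm_cons perm_sym.
move=> b c; rewrite !mem_rcons => bu cu bc.
rewrite /same_row has_cat -!/(same_row _ _ _) same_row_addlast.
rewrite !same_row_restr filter_rcons.
have [ab|ba] := ltP a b.
  rewrite /= sT //; first 1 last.
  - by move: bu; rewrite in_cons gt_eqF.
  - by move: cu; rewrite in_cons gt_eqF // (lt_le_trans ab).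
  have nb x : x <= a -> b <= x = false.
    by move=> xa; apply: lt_geF; apply: le_lt_trans ab.
  rewrite nb // (lt_le_trans ab bc) /=.
  case: (boolP (b \in a :: _)) => [/lla|//].
  by rewrite leNgt ab.
have [ca|ac|Eca] := ltgtP c a.
- have bu' : b \in u by move: bu; rewrite in_cons lt_eqF // (le_lt_trans bc).
  have cu' : c \in u by move: cu; rewrite in_cons lt_eqF.
  rewrite orbF /= !in_cons !lt_eqF ?(le_lt_trans bc) //= -sT // ba (ltW ca) /=.
  case: (boolP (same_row T b c)) => //= nbc; apply/negbTE; move: nbc.
  apply: contra => bcl.
  have: same_row L b c.
    case/lastP: (L) bcl => // L' l; rewrite last_rcons => bcl.
    by rewrite /same_row has_rcons bcl.
  by rewrite same_row_restr => /and3P[].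
- rewrite /= sorted_rcons (lt_geF ac) andbF /=.
  case: (boolP (c \in a :: _)) => [/lla|_].
    by rewrite leNgt ac.
  rewrite !andbF /=; apply/esym/negbTE; rewrite negb_and; apply/orP; right.
  apply/allPn; exists c; last by rewrite -ltNge.
  rewrite mem_filter bc lexx /=.
  by move: cu; rewrite in_cons gt_eqF.
- subst c; rewrite /= ba lexx orbF sorted_rcons.
  have -> : all (<= a) [seq x <- u | b <= x <= a].
    by apply/allP=> x; rewrite mem_filter => /andP[/andP[]].
  rewrite !andbT mem_head andbT in_cons.
  have [Eba|nba] := eqVneq b a.
    rewrite /= orbT; apply/esym.
    have /all_pred1P -> : all (pred1 a) [seq x <- u | b <= x <= a].
      apply/allP=> x; rewrite mem_filter Eba => /andP[ax _].
      by rewrite /= eq_le andbC.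
    rewrite (sorted_pairwise le_trans); elim: (size _) => //= k ->.
    by rewrite andbT; apply/allP=> x /nseqP[->].
  have bu' : b \in u by move: bu; rewrite in_cons (negPf nba).
  have bL : b \in flatten L by rewrite memL bc.
  have LT y : y <= a -> same_row L b y = same_row T b y.
    by move=> ya; rewrite same_row_restr /= ba ya.
  rewrite -LT //.
  case/lastP: (L) bL tL memL lL LT => // L' l.
  rewrite last_rcons -cats1 tab_cat tab_cons /= flatten_cat /= cats0 allrel0r.
  move=> bL /and3P[_ /and4P[l0 sl _ _] /allrelP Ll] memL lL LT.
  have [x xl xmax] :
      exists2 x, x \in l & forall y, y \in flatten L' ++ l -> y <= x.
    move: l0; case/lastP: {bL memL lL LT} l sl Ll => // l x.
    rewrite sorted_rcons => /andP[_ /allP lx] Ll _.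
    have xx : x \in rcons l x by rewrite mem_rcons mem_head.
    exists x => // y; rewrite mem_cat mem_rcons in_cons.
    by case/or3P=> [/Ll/(_ xx)/ltW|/eqP->|/lx].
  have := lL _ xl; rewrite memL => /andP[xa xu].
  have rowl y : y \in l -> same_row (L' ++ [:: l]) b y = (b \in l).
    move=> yl; rewrite /same_row has_cat /= yl andbT orbF.
    case: hasP => // -[r rL' /andP[_ yr]].
    have /Ll/(_ yl) : y \in flatten L' by apply/flattenP; exists r.
    by rewrite ltxx.
  have -> : [seq y <- u | b <= y <= a] = [seq y <- u | b <= y <= x].
    apply: eq_in_filter => y yu; congr (_ && _); apply/idP/idP => [ya|].
      by apply: xmax; rewrite memL ya.
    by move/le_trans; apply.
  rewrite -sT ?xmax // -LT // (rowl x) //.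
  apply/orP/idP => [[ra|//]|bl]; last by right.
  rewrite -(rowl x) //.
  have : a \in flatten (L' ++ [:: l]) by case/same_row_mem/andP: ra.
  rewrite flatten_cat /= cats0 => /xmax ax.
  by have <- : a = x by apply/le_anti/andP.
Qed.

Local Lemma eq_tab T S : tab T -> tab S -> flatten T = flatten S ->
  {in flatten T &, same_row T =2 same_row S} -> T = S.
Proof.
elim: T S => [|r T IH] [|s S] //.
- by rewrite tab_cons; case: s.
- by rewrite tab_cons; case: r.
move=> trT tsS eTS sTS.
have first_row x q Q : tab (q :: Q) -> x \in q ->
    [seq y <- flatten (q :: Q) | same_row (q :: Q) x y] = q.
  rewrite tab_cons => /and4P[_ _ /allrelP qQ _] xq; rewrite /= filter_cat.
  have sQ y : same_row Q x y = false.
    apply/negP => /same_row_mem/andP[/(qQ _ _ xq)].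
    by rewrite ltxx.
  rewrite -[RHS]cats0; congr (_ ++ _).
    by apply/all_filterP/allP=> y yq; rewrite xq yq.
  rewrite (eq_in_filter (a2 := pred0)) ?filter_pred0 // => y yQ.
  rewrite sQ orbF xq /=; apply/negP => /qQ/(_ yQ).
  by rewrite ltxx.
have [x xr xs] : exists2 x, x \in r & x \in s.
  move: trT tsS eTS; rewrite !tab_cons.
  case: (r) (s) => [|x r'] // [|y s'] // _ _ [-> _].
  by exists y; apply: mem_head.
have xrT : x \in flatten (r :: T) by rewrite /= mem_cat xr.
have Ers : r = s.
  rewrite -(first_row x r T) // -(first_row x s S) // -eTS.
  by apply: eq_in_filter => y yrT; apply: sTS.
subst s; congr (_ :: _).
move: eTS => /= /(congr1 (drop (size r))); rewrite !drop_size_cat // => eTS.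
move: (trT) (tsS); rewrite !tab_cons.
move=> /and4P[_ _ /allrelP rT tT] /and4P[_ _ _ tS].
apply: IH => // y z yT zT.
have := sTS y z; rewrite /= !mem_cat yT zT !orbT => /(_ isT isT).
suff -> : y \in r = false by [].
by apply/negP => /rT/(_ yT); rewrite ltxx.
Qed.

Local Lemma sorted_interval s :
  {in s &, forall x y, x <= y -> sorted <=%O [seq z <- s | x <= z <= y]} ->
  sorted <=%O s.
Proof.
elim: s => // z s IH zs; rewrite (sorted_pairwise le_trans) /=.
rewrite -(sorted_pairwise le_trans); apply/andP; split.
  apply/allP=> y ys; rewrite leNgt; apply/negP => yz.
  have := zs y z; rewrite !mem_head !in_cons ys orbT => /(_ isT isT (ltW yz)).
  rewrite /= (ltW yz) lexx (sorted_pairwise le_trans) /= => /andP[/allP + _].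
  by move/(_ y); rewrite mem_filter lexx ltW //= ys leNgt yz => /(_ isT).
apply: IH => x y xs ys xy; have := zs x y.
rewrite !in_cons xs ys !orbT => /(_ isT isT xy) /=.
by case: ifP => // _ /path_sorted.
Qed.

Lemma hypo_congrP u v : hypo_congr u v <->
  perm_eq u v /\ forall b c, sorted <=%O [seq x <- u | b <= x <= c]
                           = sorted <=%O [seq x <- v | b <= x <= c].
Proof.
have [tu pu su] := P_hypoP u; have [tv pv sv] := P_hypoP v.
split=> [/eqP uv|[uv suv]].
  have puv : perm_eq u v by rewrite -(permPl pu) uv.
  split=> // b c.
  have sub s t : perm_eq s t -> {in s &, forall x y, x <= y ->
      sorted <=%O [seq z <- s | x <= z <= y] =
      sorted <=%O [seq z <- t | x <= z <= y]} ->
      sorted <=%O [seq z <- s | b <= z <= c] ->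
      sorted <=%O [seq z <- t | b <= z <= c].
    move=> st eqst ss; apply: sorted_interval => x y.
    rewrite !mem_filter -!(perm_mem st) => /andP[/andP[bx xc] xs].
    move=> /andP[/andP[by_ yc] ys] xy.
    have Ef w : [seq z <- [seq z <- w | b <= z <= c] | x <= z <= y] =
      [seq z <- w | x <= z <= y].
      rewrite -filter_predI; apply: eq_filter => z /=.
      case: (boolP (x <= z <= y)) => //= /andP[xz zy].
      by rewrite (le_trans bx xz) (le_trans zy yc).
    rewrite Ef -eqst // -Ef; apply: sorted_filter => //; exact: le_trans.
  have eqs : {in u &, forall x y, x <= y ->
      sorted <=%O [seq z <- u | x <= z <= y] =
      sorted <=%O [seq z <- v | x <= z <= y]}.
    move=> x y xu yu xy; rewrite -su // uv sv //.
      by rewrite -(perm_mem puv).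
    by rewrite -(perm_mem puv).
  apply/idP/idP; apply: sub => //; first by rewrite perm_sym.
  by move=> x y; rewrite -!(perm_mem puv) => xu yu xy; rewrite eqs.
have pP : perm_eq (flatten (P_hypo u)) (flatten (P_hypo v)).
  by rewrite (permPl pu) perm_sym (permPl pv) perm_sym.
have sC T b c : same_row T b c = same_row T c b.
  by apply: eq_has => r; rewrite andbC.
have suv' b c : b \in u -> c \in u -> b <= c ->
    same_row (P_hypo u) b c = same_row (P_hypo v) b c.
  by move=> bu cu bc; rewrite su // sv // -(perm_mem uv).
apply/eqP/eq_tab => //.
  by apply: (sorted_eq le_trans le_anti) => //; apply: tab_sorted.
move=> b c; rewrite !(perm_mem pu) => bu cu.
have /orP[bc|cb] := le_total b c; first exact: suv'.
by rewrite sC [RHS]sC; apply: suv'.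
Qed.

Lemma P_hypo_quasi_ribbon u : quasi_ribbon (P_hypo u).
Proof. by have [/tab_quasi_ribbon] := P_hypoP u. Qed.

Lemma sorted_le_cat u v : sorted <=%O (u ++ v) =
  [&& sorted <=%O u, sorted <=%O v & allrel <=%O u v].
Proof.
by rewrite !(sorted_pairwise le_trans) pairwise_cat andbC andbA.
Qed.

Lemma hypo_congr_refl : reflexive hypo_congr.
Proof. by move=> u; apply: eqxx. Qed.

Lemma hypo_congr_sym : symmetric hypo_congr.
Proof. by move=> u v; apply: eq_sym. Qed.

Lemma hypo_congr_trans : transitive hypo_congr.
Proof. by move=> v u w /eqP uv /eqP vw; apply/eqP; rewrite uv. Qed.

Lemma hypo_congr_catl u v w : hypo_congr u v -> hypo_congr (w ++ u) (w ++ v).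
Proof.
move=> /hypo_congrP[uv suv]; apply/hypo_congrP.
split=> [|b c]; first by rewrite perm_cat2l.
rewrite !filter_cat !sorted_le_cat suv; do 2!congr (_ && _).
by apply: eq_all => x; apply/perm_all/perm_filter.
Qed.

Lemma hypo_congr_catr u v w : hypo_congr u v -> hypo_congr (u ++ w) (v ++ w).
Proof.
by move=> /eqP uv; rewrite /hypo_congr /P_hypo !foldl_cat -!/(P_hypo _) uv.
Qed.

Canonical hypo_equiv :=
  EquivRel hypo_congr hypo_congr_refl hypo_congr_sym hypo_congr_trans.

End QuasiRibbonTableaux.

(* The hypoplactic monoid over a totally ordered alphabet. The rank n         *)
(* hypoplactic monoid is [hypo 'I_n], where the ordinal i stands for the      *)
(* letter i + 1.                                                              *)
Local Open Scope quotient_scope.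
Definition hypo (d : Order.disp_t) (A : orderType d) :=
  {eq_quot (@hypo_congr d A)}.

Section HypoplacticMonoid.

Variables (d : Order.disp_t) (A : orderType d).
Local Open Scope quotient_scope.

HB.instance Definition _ := Choice.on (hypo A).
HB.instance Definition _ := EqQuotient.on (hypo A).

Definition hypo_one : hypo A := \pi_(hypo A) [::].
Definition hypo_mul (p q : hypo A) : hypo A := \pi_(hypo A) (repr p ++ repr q).

Lemma hypo_mul_pi u v :
  hypo_mul (\pi_(hypo A) u) (\pi_(hypo A) v) = \pi_(hypo A) (u ++ v).
Proof.
apply/eqmodP; apply: (@hypo_congr_trans _ _ (u ++ repr (\pi_(hypo A) v))).
  by apply/hypo_congr_catr/eqmodP; rewrite reprK.
by apply/hypo_congr_catl/eqmodP; rewrite reprK.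
Qed.

Fact hypo_mulA : associative hypo_mul.
Proof.
elim/quotW=> u; elim/quotW=> v; elim/quotW=> w.
by rewrite (hypo_mul_pi v w) (hypo_mul_pi u v) !hypo_mul_pi catA.
Qed.

Fact hypo_mul1 : left_id hypo_one hypo_mul.
Proof. by elim/quotW=> u; rewrite (hypo_mul_pi [::] u). Qed.

Fact hypo_mulr1 : right_id hypo_one hypo_mul.
Proof. by elim/quotW=> u; rewrite (hypo_mul_pi u [::]) cats0. Qed.

HB.instance Definition _ :=
  isMonoid.Build (hypo A) hypo_mulA hypo_mul1 hypo_mulr1.

End HypoplacticMonoid.

(* Main.v *)
Require Import Defs.
From mathcomp Require Import all_boot all_order.

(** Compare growth rates. The contents of words with at most k
occurrences of each letter give (k + 1)^n elements of hypo_n. An embedding f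
multiplies lengths by at most a constant c, and an element of hypo_m is
determined by its content and by a bounded amount D of inversion data. So
(k + 1)^n <= (c n k + 1)^m D for all k, which forces n <= m. *)

Set Implicit Arguments.
Unset Strict Implicit.
Unset Printing Implicit Defensive.

Local Open Scope quotient_scope.

Lemma count_mem_ltnS (T : eqType) (s : seq T) (x : T) (K : nat) :
  size s <= K -> count_mem x s < K.+1.
Proof. by rewrite ltnS; apply/leq_trans/count_size. Qed.

Section Code.

Context {d : Order.disp_t} {B : finOrderType d}.
Implicit Types u v : seq B.

(** The inversions are recorded as in [hypo_congrP], by one boolean per pair of letters, so the
    number of possible second components does not depend on [K]. The counts are faithful only when
    at most [K], since [inord] sends larger values to a default. *)
Definition hypo_code (K : nat) u :
    {ffun B -> 'I_K.+1} * {ffun B * B -> bool} :=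
  ([ffun x => inord (count_mem x u)],
   [ffun bc => sorted <=%O [seq x <- u | (bc.1 <= x <= bc.2)%O]]).

Lemma hypo_code_inj (K : nat) u v : size u <= K -> size v <= K ->
  hypo_code K u = hypo_code K v -> hypo_congr u v.
Proof.
move=> uK vK [/ffunP cuv /ffunP suv]; apply/hypo_congrP; split=> [|b c].
  apply/allP=> x _ /=; apply/eqP; have := congr1 val (cuv x).
  by rewrite !ffunE /= !inordK // count_mem_ltnS.
by have := suv (b, c); rewrite !ffunE.
Qed.

End Code.

Section ContentWord.

Context {d : Order.disp_t} {A : finOrderType d}.

Definition content_word (k : nat) (e : {ffun A -> 'I_k.+1}) : seq A :=
  flatten [seq nseq (e i) i | i <- enum A].

Lemma count_content_word (k : nat) (e : {ffun A -> 'I_k.+1}) (x : A) :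
  count_mem x (content_word e) = e x.
Proof.
rewrite /content_word count_flatten -map_comp sumnE big_map big_enum /=.
rewrite (bigD1 x) //= count_nseq /= eqxx mul1n big1 ?addn0 // => i ix.
by rewrite count_nseq /= (negPf ix).
Qed.

Lemma size_content_word (k : nat) (e : {ffun A -> 'I_k.+1}) :
  size (content_word e) <= #|A| * k.
Proof.
rewrite /content_word size_flatten /shape -map_comp sumnE big_map big_enum /=.
rewrite -sum_nat_const; apply: leq_sum => i _.
by rewrite size_nseq -ltnS.
Qed.

(** Congruent words have the same content, and the content of [content_word e] is [e]. *)
Lemma content_word_inj (k : nat) (e e' : {ffun A -> 'I_k.+1}) :
  \pi_(hypo A) (content_word e) = \pi_(hypo A) (content_word e') -> e = e'.
Proof.
move=> /eqmodP/hypo_congrP[ee' _]; apply/ffunP=> x; apply/val_inj => /=.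
by rewrite -!count_content_word; apply/permP.
Qed.

End ContentWord.

(** The congruence preserves content, hence length: the size of a representative is a well-defined
    length on [hypo A]. *)
Lemma size_repr_pi (d : Order.disp_t) (A : orderType d) (u : seq A) :
  size (repr (\pi_(hypo A) u)) = size u.
Proof.
apply: perm_size.
have /eqmodP/hypo_congrP[] // : repr (\pi_(hypo A) u) = u %[mod hypo A].
by rewrite reprK.
Qed.

Lemma size_repr_mul (d : Order.disp_t) (A : orderType d) (p q : hypo A) :
  size (repr (hypo_mul p q)) = size (repr p) + size (repr q).
Proof. by rewrite size_repr_pi size_cat. Qed.

Lemma size_repr_morph (d d' : Order.disp_t) (A : finOrderType d)
    (B : orderType d') (f : hypo A -> hypo B) (u : seq A) :
    monoid_morphism f ->
  size (repr (f (\pi_(hypo A) u)))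
    <= (\max_(a : A) size (repr (f (\pi_(hypo A) [:: a])))) * size u.
Proof.
case=> f1 fM; elim: u => [|a u IH].
  by rewrite muln0 (f1 : f (\pi_(hypo A) [::]) = _) size_repr_pi.
have -> : \pi_(hypo A) (a :: u)
    = hypo_mul (\pi_(hypo A) [:: a]) (\pi_(hypo A) u) by rewrite hypo_mul_pi.
(* The morphism law is restated up to conversion so that it matches [hypo_mul]. *)
rewrite (fM : forall p q, f (hypo_mul p q) = hypo_mul (f p) (f q)).
rewrite size_repr_mul mulnS leq_add //.
exact: (leq_bigmax (F := fun a => size (repr (f (\pi_(hypo A) [:: a]))))).
Qed.

(** If [m < n], the choice [k = C.+1 ^ m * D] bounds the right side by [k * k.+1 ^ m], which is less
    than [k.+1 ^ m.+1], hence than [k.+1 ^ n]. *)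
Lemma leq_exp_of_growth (n m C D : nat) :
  (forall k, k.+1 ^ n <= (C * k).+1 ^ m * D) -> n <= m.
Proof.
move=> growth; rewrite leqNgt; apply/negP => mn.
pose k := C.+1 ^ m * D.
have := growth k; apply/negP; rewrite -ltnNge.
have Ck : (C * k).+1 <= C.+1 * k.+1.
  by rewrite mulSn addSn ltnS mulnS addnA leq_addl.
apply: (@leq_ltn_trans ((C.+1 * k.+1) ^ m * D)).
  by rewrite leq_mul //; case: (m) => [//|m']; rewrite leq_exp2r.
rewrite expnMn mulnAC -/k.
apply: (@leq_trans (k.+1 ^ m.+1)); last by rewrite leq_pexp2l.
by rewrite expnS ltn_pmul2r // expn_gt0.
Qed.

Theorem hypo_embedding_leq_card (d d' : Order.disp_t) (A : finOrderType d)
    (B : finOrderType d') (f : hypo A -> hypo B) :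
  monoid_morphism f -> injective f -> #|A| <= #|B|.
Proof.
move=> fM f_inj.
set c := \max_(a : A) size (repr (f (\pi_(hypo A) [:: a]))).
apply: (@leq_exp_of_growth _ _ (c * #|A|) (#|{ffun B * B -> bool}|)) => k.
pose g (e : {ffun A -> 'I_k.+1}) := repr (f (\pi_(hypo A) (content_word e))).
have gK e : size (g e) <= c * #|A| * k.
  apply: leq_trans (size_repr_morph _ fM) _.
  by rewrite -mulnA leq_mul2l size_content_word orbT.
(* Distinct contents give distinct classes, [f] keeps them distinct, and the length bound [gK] makes
   their codes distinct. *)
have code_inj : injective (fun e => hypo_code (c * #|A| * k) (g e)).
  move=> e e' /(hypo_code_inj (gK e) (gK e')) gee'.
  apply/content_word_inj/f_inj; rewrite -[LHS]reprK -[RHS]reprK.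
  exact/eqmodP.
(* Comparing cardinals gives the growth inequality with exponents [#|A|] and [#|B|]. *)
by have := leq_card _ code_inj; rewrite card_prod !card_ffun !card_ord.
Qed.

Theorem proposition3p1 (n m : nat) (Hm : 1 <= m) (Hmn : m < n) :
  ~ exists2 f : hypo 'I_n -> hypo 'I_m, monoid_morphism f & injective f.
Proof.
case=> f fM f_inj; have := hypo_embedding_leq_card fM f_inj.
by rewrite !card_ord leqNgt Hmn.
Qed.
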